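(* A finite simple graph is layered if and only if it has a very nice edge-coloring.
   Context: The hypercube $Q_n$ ($n$ a natural number) is the graph with vertex set $\{A : A\subseteq [n]\}$, where $[n]=\{1,\dots,n\}$, and edge set all pairs $\{A,B\}$ with $A\subseteq B$ and $|A|=|B|-1$. The $k$th vertex layer of $Q_n$ is $V_k=\binom{[n]}{k}$, and the $k$th edge layer of $Q_n$ is the subgraph of $Q_n$ induced by $V_k\cup V_{k-1}$. A graph is layered if it is (isomorphic to) a subgraph of some edge layer of $Q_n$ for some $n$. An edge-coloring (an arbitrary assignment of colors to edges, not assumed proper) of a graph is nice if in every cycle each color appears an even number of times, and in every path with at least one edge there is a color that appears an odd number of times. An edge-coloring is very nice if it is nice and, for any two edges of the same color, any path between them (i.e. joining an endpoint of one to an endpoint of the other) that has no edges of that color has even length. *)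

(* Defs.v *)
From mathcomp Require Import all_boot.

Set Implicit Arguments.
Unset Strict Implicit.
Unset Printing Implicit Defensive.

(* [#|B| = #|A| - 1] would be wrong with truncated subtraction: it would put a
   loop at [set0]. *)
Definition hypercube (n : nat) : rel {set 'I_n} :=
  fun A B => [|| (A \subset B) && (#|B| == #|A|.+1)
               | (B \subset A) && (#|A| == #|B|.+1)].

Definition vertex_layer (n k : nat) : {set {set 'I_n}} :=
  [set A : {set 'I_n} | #|A| == k].

(* Meaningful for 0 < k only, as the layer below V_k is written V_(k.-1). *)
Definition edge_layer_verts (n k : nat) : {set {set 'I_n}} :=
  vertex_layer n k :|: vertex_layer n k.-1.

Definition edge_layer (n k : nat) : rel {set 'I_n} :=
  fun A B => [&& A \in edge_layer_verts n k, B \in edge_layer_verts n k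
               & hypercube A B].

(* The subgraph need not be induced, so edges are only preserved. *)
Definition layered (T : finType) (e : rel T) : Prop :=
  exists n k : nat, 0 < k <= n /\
  exists f : T -> {set 'I_n},
    [/\ injective f,
        forall x, f x \in edge_layer_verts n k
      & forall x y, e x y -> edge_layer k (f x) (f y)].

Definition edge_set (T : finType) (e : rel T) : {set {set T}} :=
  [set E : {set T} | [exists x, [exists y, e x y && (E == [set x; y])]]].

Definition walk_edges (T : finType) (x : T) (p : seq T) : seq {set T} :=
  pairmap (fun u v => [set u; v]) x p.

Definition cycle_edges (T : finType) (s : seq T) : seq {set T} :=
  if s is x :: p then walk_edges x (rcons p x) else [::].

(* [x :: p] is the vertex sequence of a path with [size p] edges. *)
Definition graph_path (T : finType) (e : rel T) (x : T) (p : seq T) : bool :=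
  path e x p && uniq (x :: p).

Definition graph_cycle (T : finType) (e : rel T) (s : seq T) : bool :=
  [&& cycle e s, uniq s & 2 < size s].

(* An edge-coloring is a function [c] on all sets of vertices, of which only the
   values on [edge_set e] are ever used. *)
Definition nice (T : finType) (e : rel T) (C : eqType) (c : {set T} -> C) :
    Prop :=
  (forall s, graph_cycle e s ->
     forall a : C, ~~ odd (count_mem a (map c (cycle_edges s)))) /\
  (forall x p, graph_path e x p -> 0 < size p ->
     exists a : C, odd (count_mem a (map c (walk_edges x p)))).

Definition very_nice (T : finType) (e : rel T) (C : eqType)
    (c : {set T} -> C) : Prop :=
  nice e c /\
  (forall E F : {set T}, E \in edge_set e -> F \in edge_set e -> E != F ->
     c E = c F ->
     forall x p, graph_path e x p -> x \in E -> last x p \in F ->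
       c E \notin map c (walk_edges x p) -> ~~ odd (size p)).

(* Main.v *)
Require Import Defs.
From mathcomp Require Import all_boot.

Set Implicit Arguments.
Unset Strict Implicit.
Unset Printing Implicit Defensive.

(** If the graph lies in an edge layer, color each edge with the one element in
    which its two end sets differ.  Along a walk, a color [i] occurs an odd
    number of times exactly when membership of [i] differs at the two ends
    ([odd_count_dcolor]), so the coloring is nice.  An end of an edge of color
    [i] contains [i] exactly when it is in the upper of the two vertex layers,
    so a path without color [i] joining two such edges starts and stops in the
    same vertex layer and has even length.

    Conversely, in a nice coloring every closed walk has each color an even
    number of times ([closed_walk_even]).  Hence the parity [parity a x] of
    the number of edges of color [a] on a walk to [x] from the root of its
    component does not depend on the walk, and neither does the parity [side x]
    of the length of the walk.  The sets of colors [a] with [parity a x] true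
    already embed each component in the hypercube; to put the image in one edge
    layer, coordinate [a] has to be flipped on some components, so that each
    edge of color [a] gains [a] from side 0 to side 1.  The right choice for one
    edge of color [a] is right for all others of its component exactly because
    on every path between two such edges the length and the number of edges of
    color [a] have the same parity ([same_color_parity]); this is where the
    coloring being very nice is used.  Finally the components are given disjoint
    ground sets, and the complement of the set at the root is added to all sets
    of the component, so that all roots get sets of the same size. *)

(** * Parities along walks *)

Section Walks.

Variables (T : finType) (e : rel T).
Hypotheses (e_sym : symmetric e) (e_irr : irreflexive e).

Lemma size_walk_edges x (p : seq T) : size (walk_edges x p) = size p.
Proof. exact: size_pairmap. Qed.

Lemma walk_edges_cat x (p q : seq T) :
  walk_edges x (p ++ q) = walk_edges x p ++ walk_edges (last x p) q.
Proof. exact: pairmap_cat. Qed.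

Lemma walk_edges_rcons x p (y : T) :
  walk_edges x (rcons p y) = rcons (walk_edges x p) [set last x p; y].
Proof. by rewrite -cats1 walk_edges_cat cats1. Qed.

Lemma walk_edges_split (P : pred {set T}) x p :
  has P (walk_edges x p) ->
  exists p1 y p2, p = p1 ++ y :: p2 /\ P [set last x p1; y].
Proof.
elim: p x => //= y p IHp x /orP[Pxy | /IHp[p1 [z [p2 [-> Pz]]]]].
  by exists [::], y, p.
by exists (y :: p1), z, p2.
Qed.

Lemma walk_rev (P : pred {set T}) x p : path e x p ->
  exists q, [/\ path e (last x p) q, last (last x p) q = x
    & count P (walk_edges (last x p) q) = count P (walk_edges x p)].
Proof.
elim: p x => [|y p IHp] x /=; first by exists [::].
case/andP=> exy /IHp[q [e_q last_q cnt_q]]; exists (rcons q x).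
rewrite rcons_path last_rcons last_q walk_edges_rcons last_q -cats1 count_cat.
by rewrite e_q e_sym exy cnt_q /= addn0 addnC (setUC [set y]).
Qed.

Lemma edge_setP (E : {set T}) :
  reflect (exists x y, e x y /\ E = [set x; y]) (E \in edge_set e).
Proof.
rewrite inE; apply: (iffP existsP) => [[x /existsP[y /andP[exy /eqP->]]] | ].
  by exists x, y.
by case=> x [y [exy ->]]; exists x; apply/existsP; exists y; rewrite exy eqxx.
Qed.

Lemma edge_set2 x y : e x y -> [set x; y] \in edge_set e.
Proof. by move=> exy; apply/edge_setP; exists x, y. Qed.

Lemma not_uniq_split (p : seq T) : ~~ uniq p ->
  exists p1 y p2 p3, p = p1 ++ y :: p2 ++ y :: p3.
Proof.
elim: p => //= x p IHp; rewrite negb_and negbK => /orP[|/IHp].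
  by case/splitPr=> p2 p3; exists [::], x, p2, p3.
by case=> [p1 [y [p2 [p3 ->]]]]; exists (x :: p1), y, p2, p3.
Qed.

(** If [P] holds for an even number of edges in every cycle, then so it does in
    every closed walk, which decomposes into cycles and into edges traversed
    back and forth. *)
Lemma closed_walk_even (P : pred {set T}) :
    (forall s, graph_cycle e s -> ~~ odd (count P (cycle_edges s))) ->
  forall x p, path e x p -> last x p = x -> ~~ odd (count P (walk_edges x p)).
Proof.
move=> cycP x p; have [n] := ubnP (size p).
elim: n x p => // n IHn x p /ltnSE-le_p_n e_p last_p.
have [Up | /not_uniq_split[p1 [y [p2 [p3 Dp]]]]] := boolP (uniq p); last first.
  (* Cut the closed subwalk at [y] out of the walk. *)
  move: le_p_n e_p last_p; rewrite {p}Dp.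
  rewrite !(size_cat, cat_path, last_cat, walk_edges_cat) /=.
  rewrite !(size_cat, cat_path, last_cat, walk_edges_cat) /= => le_p_n.
  case/and4P=> e_p1 e_y /= e_p2 /andP[e_y' e_p3] last_p3.
  have := IHn y (rcons p2 y); rewrite walk_edges_rcons size_rcons last_rcons.
  rewrite rcons_path e_p2 e_y' => /(_ _ isT erefl).
  have := IHn x (p1 ++ y :: p3).
  rewrite size_cat cat_path last_cat walk_edges_cat /= e_p1 e_y e_p3.
  move=> /(_ _ isT last_p3) IH1 IH2.
  have lt1 : size p1 + (size p3).+1 < n.
    by apply: leq_trans le_p_n; rewrite -addnS leq_add2l ltnS leq_addl.
  have lt2 : (size p2).+1 < n.
    by apply: leq_trans le_p_n; rewrite !addnS !ltnS addnCA leq_addr.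
  move: {IH1}(IH1 lt1) {IH2}(IH2 lt2).
  rewrite -cats1 !count_cat /= ?count_cat /= !oddD ?oddb /=.
  by do 3!case: (odd (count _ _)); do 2!case: (P _).
case/lastP: p Up le_p_n e_p last_p => // p z Uzp _ e_p.
rewrite last_rcons => Dz; rewrite {z}Dz in Uzp e_p *.
(* The vertices after the start of the walk are distinct, so it is a loop, an
   edge traversed back and forth, or a cycle. *)
case: p Uzp e_p => [|y [|z p]] Uxp e_p.
- by rewrite /= e_irr in e_p.
- by rewrite /= (setUC [set y]); case: (P _).
by apply: (cycP (x :: y :: z :: p)); apply/and3P; rewrite cons_uniq -rcons_uniq.
Qed.

Lemma size_even_count (C : eqType) (s : seq C) :
  (forall a, ~~ odd (count_mem a s)) -> ~~ odd (size s).
Proof.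
have [n] := ubnP (size s); elim: n s => // n IHn [|a s] // /ltnSE-le_s_n even_s.
rewrite -(count_predC (pred1 a)) oddD negb_add (negbTE (even_s a)).
rewrite -size_filter eq_sym eqbF_neg; apply: IHn => [|b].
  rewrite size_filter /= eqxx /=.
  exact: leq_ltn_trans (count_size _ _) le_s_n.
rewrite count_filter; have [->|ba] := eqVneq b a.
  by rewrite (@eq_count _ _ pred0) ?count_pred0 // => d /=; rewrite andbN.
rewrite (@eq_count _ _ (pred1 b)) ?even_s // => d /=.
by case: eqP => // ->; rewrite ba.
Qed.

Let e_csym : connect_sym e := sym_connect_sym e_sym.

Lemma walk_to_subproof x :
  exists p, path e (root e x) p && (last (root e x) p == x).
Proof.
have /connectP[p e_p Dx] : connect e (root e x) x.
  by rewrite e_csym connect_root.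
by exists p; rewrite e_p eq_sym; apply/eqP.
Qed.

(** A walk to [x] from the root of its component. *)
Definition walk_to x : seq T := xchoose (walk_to_subproof x).

Lemma walk_toP x :
  path e (root e x) (walk_to x) /\ last (root e x) (walk_to x) = x.
Proof. by have /andP[? /eqP] := xchooseP (walk_to_subproof x). Qed.

(** The parity of the number of edges satisfying [P] on a walk to [x] from the
    root of its component. *)
Definition walk_parity (P : pred {set T}) x : bool :=
  odd (count P (walk_edges (root e x) (walk_to x))).

Lemma root_path x p : path e x p -> root e (last x p) = root e x.
Proof.
move=> e_p; apply/eqP; rewrite (root_connect e_csym) e_csym.
by apply/connectP; exists p.
Qed.

Lemma root_edge x y : e x y -> root e y = root e x.
Proof. by move=> exy; apply: (@root_path x [:: y]); rewrite /= exy. Qed.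

Section Potential.

Variable P : pred {set T}.
Hypothesis cycP :
  forall s, graph_cycle e s -> ~~ odd (count P (cycle_edges s)).

Lemma walk_parity_edge x y : e x y ->
  walk_parity P y = walk_parity P x (+) P [set x; y].
Proof.
move=> exy; have rxy := root_edge exy.
have [e_x last_x] := walk_toP x; have [e_y last_y] := walk_toP y.
rewrite rxy in e_y last_y.
(* Close the walk to [x] with the edge to [y] and the reverse of the walk to
   [y]. *)
have [q [e_q last_q cnt_q]] := walk_rev P e_y.
rewrite last_y in e_q last_q cnt_q.
have := closed_walk_even cycP (x := root e x) (p := walk_to x ++ y :: q).
rewrite cat_path last_cat walk_edges_cat /= last_x e_x exy e_q last_q.
move=> /(_ isT erefl); rewrite count_cat /= cnt_q /walk_parity rxy !oddD oddb.
by do 2!case: (odd (count _ _)); case: (P _).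
Qed.

Lemma odd_count_walk_parity x p : path e x p ->
  odd (count P (walk_edges x p)) = walk_parity P x (+) walk_parity P (last x p).
Proof.
elim: p x => [|y p IHp] x /=; first by rewrite addbb.
case/andP=> /walk_parity_edge phi_y /IHp IH; rewrite oddD IH phi_y oddb.
by do 2!case: (walk_parity P _); case: (P _).
Qed.

Lemma walk_parity_root x : walk_parity P (root e x) = false.
Proof.
rewrite /walk_parity; have [] := walk_toP (root e x).
rewrite (root_root e_csym).
by move=> e_p last_p; apply/negbTE/closed_walk_even.
Qed.

End Potential.

(** * From a very nice coloring to an edge layer *)

(** Any finite type may serve as the ground set of the hypercube. *)
Lemma layered_of_graded_sets (U : finType) (m : nat) (pi : T -> bool)
    (f : T -> {set U}) :
    m < #|U| -> injective f -> (forall x, #|f x| = m + pi x) ->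
    (forall x y, e x y -> pi y = ~~ pi x) ->
    (forall x y, e x y -> ~~ pi x -> f x \subset f y) ->
  layered e.
Proof.
move=> lt_m_U f_inj card_f pi_edge sub_f.
have rank_inj : injective (@enum_rank U) by apply: enum_rank_inj.
exists #|U|, m.+1; split=> //; exists (fun x => @enum_rank U @: f x).
have layerP x : @enum_rank U @: f x \in edge_layer_verts #|U| m.+1.
  rewrite !inE card_imset // card_f.
  by case: (pi x); rewrite ?addn1 ?addn0 eqxx ?orbT.
split=> // [x y /(imset_inj rank_inj)/f_inj // | x y exy].
rewrite /edge_layer !layerP /hypercube !card_imset // !card_f (pi_edge _ _ exy).
have [pi_x | npi_x] := boolP (pi x).
  have sub_yx : f y \subset f x.
    by apply: sub_f; rewrite 1?e_sym // (pi_edge _ _ exy) pi_x.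
  by rewrite (imsetS _ sub_yx) addn0 addn1 eqxx orbT.
by rewrite addn0 addn1 eqxx imsetS // sub_f.
Qed.

Section Orientation.

Variables (X : finType) (c : {set T} -> X).
Hypothesis c_vn : very_nice e c.

(** The parity of the number of edges of color [a] on a walk to a vertex from
    the root of its component. *)
Definition parity a := walk_parity [pred E | c E == a].

(** The parity of the length of a walk to a vertex from the root of its
    component: [side] is a bipartition of the graph. *)
Definition side := walk_parity predT.

Lemma count_color a s : count_mem a (map c s) = count [pred E | c E == a] s.
Proof. by rewrite count_map. Qed.

Lemma color_cycle a s :
  graph_cycle e s -> ~~ odd (count [pred E | c E == a] (cycle_edges s)).
Proof.
by move=> e_s; rewrite -count_color; case: c_vn => [[cyc _] _]; apply: cyc.
Qed.

(** A cycle has even length, as each color occurs an even number of times. *)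
Lemma length_cycle s :
  graph_cycle e s -> ~~ odd (count predT (cycle_edges s)).
Proof.
move=> e_s; rewrite count_predT -(size_map c); apply: size_even_count => a.
by rewrite count_color color_cycle.
Qed.

Lemma odd_count_parity a x p : path e x p ->
  odd (count [pred E | c E == a] (walk_edges x p))
    = parity a x (+) parity a (last x p).
Proof. exact/odd_count_walk_parity/color_cycle. Qed.

Lemma odd_size_side x p : path e x p ->
  odd (size p) = side x (+) side (last x p).
Proof.
move=> e_p; rewrite -(size_walk_edges x) -count_predT.
exact: (odd_count_walk_parity length_cycle e_p).
Qed.

Lemma parity_edge x y a : e x y ->
  parity a y = parity a x (+) (c [set x; y] == a).
Proof. exact/walk_parity_edge/color_cycle. Qed.

Lemma side_edge x y : e x y -> side y = ~~ side x.
Proof.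
by move=> exy; rewrite /side (walk_parity_edge length_cycle exy) addbT.
Qed.

(** A path without color [c E] between two edges of that color has even length
    also when the two edges are equal: if the path joined the two ends of [E],
    then closing it with [E] would give a closed walk with color [c E] exactly
    once. *)
Lemma same_color_even (E F : {set T}) x p :
    E \in edge_set e -> F \in edge_set e -> c E = c F ->
    graph_path e x p -> x \in E -> last x p \in F ->
    c E \notin map c (walk_edges x p) ->
  ~~ odd (size p).
Proof.
move=> eE eF cEF e_p xE lF cEp.
have [EF | /eqP EF] := E =P F; last first.
  by case: c_vn => _ vn; apply: vn eF _ cEF _ _ e_p xE lF cEp.
have /andP[{}e_p _] := e_p; move: lF; rewrite -EF {F eF cEF EF} => lE.
have [last_p | /eqP neq_last] := last x p =P x.
  by rewrite (odd_size_side e_p) last_p addbb.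
have DE : E = [set last x p; x].
  have /edge_setP[u [v [_ DE]]] := eE; rewrite {}DE !inE in xE lE *.
  case/pred2P: lE neq_last => ->; case/pred2P: xE => ->; rewrite ?eqxx //.
  by rewrite setUC.
have e_last : e (last x p) x.
  have /edge_setP[u [v [e_uv Duv]]] := eE.
  have: [set u; v] = [set last x p; x] by rewrite -Duv.
  move/setP=> eq_uv; move: (eq_uv u) (eq_uv v); rewrite !inE !eqxx orbT /=.
  move=> /esym/pred2P[] Du /esym/pred2P[] Dv; move: e_uv; rewrite Du Dv //.
  - by rewrite e_irr.
  - by rewrite e_sym.
  - by rewrite e_irr.
have := odd_count_parity (c E) (x := x) (p := rcons p x).
rewrite rcons_path e_p e_last last_rcons addbb => /(_ isT).
rewrite walk_edges_rcons -cats1 count_cat /= -DE eqxx oddD -count_color.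
by rewrite (count_memPn cEp).
Qed.

(** Cut the path at its edges of color [a]: the pieces have even length. *)
Lemma same_color_parity a (E F : {set T}) x p :
    E \in edge_set e -> F \in edge_set e -> c E = a -> c F = a ->
    graph_path e x p -> x \in E -> last x p \in F ->
  odd (count [pred D | c D == a] (walk_edges x p)) = odd (size p).
Proof.
have [n] := ubnP (size p).
elim: n E F x p => // n IHn E F x p /ltnSE-le_p_n eE eF cE cF e_p xE lF.
have [ap | nap] := boolP (has [pred D | c D == a] (walk_edges x p)); last first.
  rewrite [in RHS](negbTE (same_color_even eE eF _ e_p xE lF _)) ?cE //.
    by move: nap; rewrite has_count -eqn0Ngt => /eqP->.
  by rewrite -has_pred1 has_map.
have [p1 [y [p2 [Dp /= /eqP cy]]]] := walk_edges_split ap.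
move: le_p_n e_p lF; rewrite {p ap}Dp /graph_path size_cat cat_path -cat_cons.
rewrite cat_uniq last_cat walk_edges_cat count_cat.
rewrite [y :: p2]lock /= -lock => le_p_n.
case/andP=> /and3P[e_p1 e_y e_p2] /and3P[U1 _ U2] lF.
have IH1 : odd (count [pred D | c D == a] (walk_edges x p1)) = odd (size p1).
  apply: (IHn E [set last x p1; y]); rewrite ?set21 ?edge_set2 //;
    last exact/andP.
  by apply: leq_trans le_p_n; rewrite addnS ltnS leq_addr.
have IH2 : odd (count [pred D | c D == a] (walk_edges y p2)) = odd (size p2).
  apply: (IHn [set last x p1; y] F); rewrite ?set22 ?edge_set2 //;
    last exact/andP.
  by apply: leq_trans le_p_n; rewrite addnS ltnS leq_addl.
by rewrite /= cy eqxx !oddD /= IH1 IH2.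
Qed.

(** [flip a r] is true if coordinate [a] has to be flipped on the component of
    root [r], for its edges of color [a] to gain [a] towards side 1.  It is read
    off from any end [x] of such an edge. *)
Definition flip a r : bool :=
  [exists x, [exists y, [&& e x y, root e x == r, c [set x; y] == a
                          & parity a x (+) side x]]].

Lemma flipE x y : e x y ->
  flip (c [set x; y]) (root e x) = parity (c [set x; y]) x (+) side x.
Proof.
move=> exy; set a := c _.
apply/idP/idP => [|ax]; last first.
  by apply/existsP; exists x; apply/existsP; exists y; rewrite exy !eqxx.
case/existsP=> z /existsP[t /and4P[ezt /eqP rz /eqP cz az]].
have /connectP[p e_p Dx] : connect e z x.
  by rewrite -(root_connect e_csym) rz.
case/shortenP: e_p Dx => q e_q Uq _ Dx.
have := @same_color_parity a [set z; t] [set x; y] z q.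
rewrite !edge_set2 // /graph_path e_q Uq -Dx !set21.
move=> /(_ isT isT cz erefl isT isT isT).
rewrite odd_count_parity // (odd_size_side e_q) -Dx.
by move: az; do 2!case: (parity _ _); do 2!case: (side _).
Qed.

(** The set of colors assigned to [x], oriented so that every edge gains its
    color from side 0 to side 1 ([oriented_edge]).  For vertices on the same
    side, its size may still depend on the component. *)
Definition oriented x : {set X} := [set a | parity a x (+) flip a (root e x)].

Lemma oriented_edge x y : e x y -> ~~ side x ->
  c [set x; y] \notin oriented x /\ oriented y = c [set x; y] |: oriented x.
Proof.
move=> exy nx; have ax : c [set x; y] \notin oriented x.
  by rewrite inE flipE // addKb.
split=> //; apply/setP=> a; rewrite in_setU1 [a \in oriented y]inE.
rewrite (root_edge exy) (parity_edge a exy) eq_sym.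
have [->|_] := eqVneq; last by rewrite addbF inE.
by rewrite flipE //; move: nx; case: (parity _ _); case: (side _).
Qed.

Lemma oriented_inj x y :
  root e x = root e y -> oriented x = oriented y -> x = y.
Proof.
move=> rxy fxy; apply/eqP; apply/negPn/negP => nxy.
have /connectP[p e_p Dy] : connect e x y by rewrite -(root_connect e_csym) rxy.
case/shortenP: e_p Dy nxy => q e_q Uq _ Dy nxy.
have [a] : exists a, odd (count_mem a (map c (walk_edges x q))).
  case: c_vn => [[_ pth] _]; apply: pth; first exact/andP.
  by case: q {e_q Uq} Dy nxy => //= ->; rewrite eqxx.
rewrite count_color odd_count_parity // -Dy.
have := congr1 (fun A : {set X} => a \in A) fxy; rewrite !inE rxy => /addIb ->.
by rewrite addbb.
Qed.

(** Each component uses its own two copies of the set of colors, told apart by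
    a boolean: copy [true] holds [oriented x], copy [false] the complement of
    the set at the root.  The index [None] is not used; it makes the ground set
    large enough when [T] is empty. *)
Definition padded x : {set option T * X * bool} :=
  [set u | (u.1.1 == Some (root e x)) &&
     (if u.2 then u.1.2 \in oriented x else u.1.2 \notin oriented (root e x))].

Lemma in_padded x o a b : ((o, a, b) \in padded x) =
  (o == Some (root e x)) &&
     (if b then a \in oriented x else a \notin oriented (root e x)).
Proof. by rewrite in_set. Qed.

Lemma padded_edge x y : e x y -> ~~ side x ->
  exists2 u, u \notin padded x & padded y = u |: padded x.
Proof.
move=> exy nx; have [ax Dy] := oriented_edge exy nx.
exists (Some (root e x), c [set x; y], true); first by rewrite in_padded eqxx.
apply/setP=> [[[o a] b]]; rewrite in_setU1 !in_padded (root_edge exy) Dy.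
rewrite in_setU1 !xpair_eqE; case: (o =P _) => //= _.
by case: b; rewrite ?andbT // andbF.
Qed.

Lemma card_padded_root x : #|padded (root e x)| = #|X|.
Proof.
pose r := root e x; pose h a := (Some r, a, a \in oriented r).
have h_inj : injective h by move=> a b [].
rewrite -(card_imset X h_inj); apply: eq_card => [[[o a] b]].
rewrite in_padded (root_root e_csym); apply/andP/imsetP => [[/eqP-> ab] | ].
  by exists a => //; congr (_, _, _); case: b ab => // /negbTE.
by case=> a' _ [-> -> ->]; rewrite eqxx; case: ifP => // ->.
Qed.

Lemma card_padded x : #|padded x| = #|X| + side x.
Proof.
have step z y : e z y ->
  #|padded z| = #|X| + side z -> #|padded y| = #|X| + side y.
- move=> ezy; rewrite (side_edge ezy); have [sz | nsz] := boolP (side z).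
    have eyz : e y z by rewrite e_sym.
    have nsy : ~~ side y by rewrite (side_edge ezy) sz.
    have [u uy ->] := padded_edge eyz nsy.
    by rewrite cardsU1 uy addn0 addn1 => -[].
  have [u uz ->] := padded_edge ezy nsz.
  by rewrite cardsU1 uz addn0 addnC => ->.
have [e_p <-] := walk_toP x.
have: #|padded (root e x)| = #|X| + side (root e x).
  by rewrite card_padded_root /side (walk_parity_root length_cycle) addn0.
elim: (walk_to x) (root e x) e_p => //= y p IHp z /andP[ezy e_p] card_z.
exact/IHp/(step z).
Qed.

Lemma layered_of_very_nice : layered e.
Proof.
have X_gt0 : 0 < #|X| by apply/card_gt0P; exists (c set0).
apply: (layered_of_graded_sets (m := #|X|) (pi := side) (f := padded)).
- rewrite !card_prod card_option card_bool mulSn mulnDl [_ * 2]mulnC mul2n.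
  by rewrite -addnn -addnA -[ltnLHS]addn0 ltn_add2l ltn_addr.
- (* The first components of the elements of [padded x] determine the root. *)
  move=> x y eq_xy; have rxy : root e x = root e y.
    have /card_gt0P[[[o a] b] xu] : 0 < #|padded x|.
      by rewrite card_padded ltn_addr.
    have := xu; rewrite eq_xy in_padded => /andP[/eqP Do _].
    by move: xu; rewrite in_padded Do => /andP[/eqP[]].
  apply: oriented_inj => //; apply/setP=> a.
  move/setP/(_ (Some (root e x), a, true)): eq_xy.
  by rewrite !in_padded rxy eqxx.
- exact: card_padded.
- exact: side_edge.
by move=> x y exy /(padded_edge exy)[u _ ->]; apply: subsetUr.
Qed.

End Orientation.

End Walks.

(** Whether a coloring is very nice only depends on which edges have equal
    colors. *)
Lemma very_nice_recolor (T : finType) (e : rel T) (C C' : eqType)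
    (c : {set T} -> C) (c' : {set T} -> C') :
    (forall E F, (c' E == c' F) = (c E == c F)) ->
  very_nice e c -> very_nice e c'.
Proof.
move=> cc' [[cyc pth] vn].
have count_c' E s : count_mem (c' E) (map c' s) = count_mem (c E) (map c s).
  by rewrite !count_map; apply: eq_count => F; apply: cc'.
split; first split.
- move=> s e_s a; have [/mapP[E _ ->] | /count_memPn-> //] :=
    boolP (a \in map c' (cycle_edges s)).
  by rewrite count_c' cyc.
- move=> x p e_p p_gt0; have [a odd_a] := pth x p e_p p_gt0.
  have /mapP[E _ Da] : a \in map c (walk_edges x p).
    by apply: contraLR odd_a => /count_memPn->.
  by exists (c' E); rewrite count_c' -Da.
move=> E F eE eF neqEF /eqP; rewrite cc' => /eqP cEF x p e_p xE lF c'E.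
apply: (vn E F eE eF neqEF cEF x p e_p xE lF).
by apply: contra c'E => /mapP[G pG /eqP]; rewrite -cc' => /eqP->; apply: map_f.
Qed.

(** The colors may be taken in a finite type: each one is named by a set of
    vertices of that color. *)
Lemma very_nice_finite (T : finType) (e : rel T) (C : eqType)
    (c : {set T} -> C) :
  very_nice e c -> exists c' : {set T} -> {set T}, very_nice e c'.
Proof.
move=> c_vn; pose c' E := odflt E [pick F | c F == c E].
exists c'; apply: very_nice_recolor c_vn => E F.
have c'K G : c (c' G) = c G.
  by rewrite /c'; case: pickP => [H /eqP | /(_ G)]; rewrite ?eqxx.
apply/eqP/eqP => [/(congr1 c) | cEF]; first by rewrite !c'K.
by rewrite /c' cEF; case: pickP => [//|/(_ F)]; rewrite eqxx.
Qed.

(** * From an edge layer to a very nice coloring *)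

(** Adjacent sets of an edge layer differ in one element [i], which belongs to
    the set in the upper layer only. *)
Lemma edge_layer_step n k (A B : {set 'I_n}) : 0 < k -> edge_layer k A B ->
  exists i, [/\ forall j, (j \in A) (+) (j \in B) = (j == i),
                (i \in A) = (#|A| == k) & (#|B| == k) = ~~ (#|A| == k)].
Proof.
move=> k_gt0 /and3P[]; rewrite !inE.
have step (D E : {set 'I_n}) : (D \subset E) && (#|E| == #|D|.+1) ->
    (#|D| == k) || (#|D| == k.-1) -> (#|E| == k) || (#|E| == k.-1) ->
    exists i, [/\ forall j, (j \in D) (+) (j \in E) = (j == i),
                  i \in E, #|D| == k = false & #|E| == k].
- case/andP=> sDE /eqP cardE kD kE.
  have /cards1P[i Di] : #|E :\: D| == 1.
    by rewrite cardsD (setIidPr sDE) cardE subSn // subnn.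
  have EDi j : (j \notin D) && (j \in E) = (j == i).
    by rewrite -in_setD Di in_set1.
  exists i; split.
  + move=> j; rewrite -EDi; have := subsetP sDE j.
    by case: (j \in D) => // ->.
  + by have := EDi i; rewrite eqxx => /andP[].
  + apply/eqP=> Dk; move: kE; rewrite cardE Dk -[in k.+1 == k.-1](prednK k_gt0).
    by rewrite !gtn_eqF.
  case/orP: kD => /eqP Dk; move: kE; rewrite cardE Dk ?(prednK k_gt0) ?eqxx //.
  by rewrite -[in k.+1 == k.-1](prednK k_gt0) !gtn_eqF.
move=> kA kB /orP[AB | BA].
  have [i [Di iB nkA kkB]] := step A B AB kA kB; exists i; split=> //.
    by rewrite nkA; have := Di i; rewrite iB eqxx; case: (i \in A).
  by rewrite nkA kkB.
have [i [Di iA nkB kkA]] := step B A BA kB kA; exists i; split=> //.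
- by move=> j; rewrite addbC.
- by rewrite iA kkA.
by rewrite nkB kkA.
Qed.

Section LayerColoring.

Variables (T : finType) (e : rel T) (n k : nat) (f : T -> {set 'I_n}).
Hypotheses (k_gt0 : 0 < k) (f_inj : injective f).
Hypothesis f_edge : forall x y, e x y -> edge_layer k (f x) (f y).

(** The color of [[set x; y]] is the symmetric difference of [f x] and [f y],
    which is a singleton when [x] and [y] are adjacent. *)
Definition dcolor (E : {set T}) : {set 'I_n} :=
  [set i | [exists x in E, i \in f x] && [exists x in E, i \notin f x]].

Lemma in_dcolor x y i : (i \in dcolor [set x; y]) = (i \in f x) (+) (i \in f y).
Proof.
rewrite inE; have ex2 (P : pred T) : [exists z in [set x; y], P z] = P x || P y.
  apply/exists_inP/orP => [[z /set2P[]-> Pz] | []]; [by left | by right | |].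
    by exists x; rewrite ?set21.
  by exists y; rewrite ?set22.
by rewrite !ex2; case: (i \in f x); case: (i \in f y).
Qed.

(** An end of an edge of color [[set i]] contains [i] if and only if it is in
    the upper layer. *)
Lemma dcolor_edge x y : e x y -> exists i,
  [/\ dcolor [set x; y] = [set i], (i \in f x) = (#|f x| == k),
      (i \in f y) = (#|f y| == k) & (#|f y| == k) = ~~ (#|f x| == k)].
Proof.
move=> exy; have [i [Di ix yx]] := edge_layer_step k_gt0 (f_edge exy).
exists i; split=> //; first by apply/setP=> j; rewrite in_dcolor Di in_set1.
by have := Di i; rewrite eqxx yx -ix; case: (i \in f x); case: (i \in f y).
Qed.

Lemma odd_count_dcolor x p i : path e x p ->
  odd (count_mem [set i] (map dcolor (walk_edges x p)))
    = (i \in f x) (+) (i \in f (last x p)).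
Proof.
elim: p x => [|y p IHp] x /=; first by rewrite addbb.
case/andP=> exy /IHp; rewrite oddD => ->; rewrite addbA; congr (_ (+) _).
have [j [Dj _ _ _]] := dcolor_edge exy.
have := in_dcolor x y i; rewrite Dj in_set1 (inj_eq set1_inj) oddb eq_sym => ->.
by case: (i \in f x); case: (i \in f y).
Qed.

Lemma dcolor_walk x p a : path e x p -> a \in map dcolor (walk_edges x p) ->
  exists i, a = [set i].
Proof.
elim: p x => //= y p IHp x /andP[exy /IHp IH].
rewrite inE => /predU1P[-> | /IH //].
by have [i [Di _ _ _]] := dcolor_edge exy; exists i.
Qed.

Lemma odd_size_layer x p : path e x p ->
  odd (size p) = (#|f x| == k) (+) (#|f (last x p)| == k).
Proof.
elim: p x => [|y p IHp] x /=; first by rewrite addbb.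
case/andP=> exy /IHp ->; have [_ [_ _ _ ->]] := dcolor_edge exy.
by rewrite addNb negbK.
Qed.

Lemma in_edge_layer (E : {set T}) x i : E \in edge_set e ->
  dcolor E = [set i] -> x \in E -> (i \in f x) = (#|f x| == k).
Proof.
case/edge_setP=> u [v [euv ->]]; have [j [-> ju jv _]] := dcolor_edge euv.
by move/set1_inj <- => /set2P[] ->.
Qed.

Lemma very_nice_dcolor : very_nice e dcolor.
Proof.
split; first split.
- case=> [|x p] // /and3P[e_p _ _] a.
  have [a_p | /count_memPn-> //] :=
    boolP (a \in map dcolor (cycle_edges (x :: p))).
  have [i ->] := dcolor_walk e_p a_p.
  by rewrite /cycle_edges (odd_count_dcolor i e_p) last_rcons addbb.
- move=> x p /andP[e_p /=/andP[x_p _]] p_gt0.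
  have: f x != f (last x p).
    apply: contraNneq x_p => /f_inj Dx.
    by case: p p_gt0 Dx {e_p} => //= y p _ {1}->; apply: mem_last.
  have [/existsP[i fi _] | /existsPn eq_f] :=
    boolP [exists i, (i \in f x) (+) (i \in f (last x p))].
    by exists [set i]; rewrite odd_count_dcolor.
  case/eqP; apply/setP=> i; move: (eq_f i).
  by case: (i \in f x); case: (i \in f (last x p)).
move=> E F eE eF _ cEF x p /andP[e_p _] xE lF cE.
have /edge_setP[u [v [euv DE]]] := eE.
have [i [Di _ _ _]] := dcolor_edge euv; rewrite -DE in Di.
rewrite (odd_size_layer e_p) -(in_edge_layer eE Di xE).
rewrite -(in_edge_layer eF (etrans (esym cEF) Di) lF).
by rewrite -(odd_count_dcolor i e_p) -Di (count_memPn cE).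
Qed.

End LayerColoring.

Theorem theorem1 (T : finType) (e : rel T)
    (e_sym : symmetric e) (e_irr : irreflexive e) :
  layered e <-> exists (C : eqType) (c : {set T} -> C), very_nice e c.
Proof.
split=> [[n [k [/andP[k_gt0 _] [f [f_inj _ f_edge]]]]] | [C [c c_vn]]].
  by exists {set 'I_n}, (dcolor f); apply: (very_nice_dcolor k_gt0).
have [c' c'_vn] := very_nice_finite c_vn.
exact: (layered_of_very_nice e_sym e_irr c'_vn).
Qed.
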